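(* Let $d\ge2$, $q_1,\dots,q_d\ge 2$ and $s\ge2$ be integers. Then the graphs $\mathrm{DL}(q_1^s,\dots,q_d^s)$ and $\mathrm{DL}(q_1,\dots,q_d)$ are quasi-isometric. The quasi-isometry has the following property: if $\Gamma\le\mathcal A(q_1,\dots,q_d)$, then the subgroup $$\Gamma_s=\{g=g_1\cdots g_d\in\Gamma:\ \mathfrak h(g_i)\in s\mathbb Z,\ i=1,\dots,d\}$$ embeds into $\mathcal A(q_1^s,\dots,q_d^s)$, and if $\Gamma$ acts transitively and/or with trivial stabilizers on $\mathrm{DL}(q_1,\dots,q_d)$, then $\Gamma_s$ (via this embedding) also acts transitively and/or with trivial stabilizers (respectively) on $\mathrm{DL}(q_1^s,\dots,q_d^s)$.
   Context: For an integer $q\ge 2$, $\mathbb T_q$ is the homogeneous tree in which every vertex has $q+1$ neighbours, with graph metric $d(\cdot,\cdot)$, a fixed origin $o$ and a fixed end $\omega$ (an end is a class of one-sided infinite geodesic rays, two rays being equivalent if their symmetric difference is finite). Let $x\curlywedge y$ be the maximal common ancestor of $x,y$, i.e. the first common vertex of the geodesic rays from $x$ and from $y$ that represent $\omega$. The Busemann function is $\mathfrak h(x)=d(x,x\curlywedge o)-d(o,x\curlywedge o)$. With $T_j=\mathbb T_{q_j}$, the Diestel-Leader graph $\mathrm{DL}(q_1,\dots,q_d)$ has vertex set $\{x_1\cdots x_d\in T_1\times\dots\times T_d:\ \mathfrak h(x_1)+\dots+\mathfrak h(x_d)=0\}$, and $x_1\cdots x_d$, $y_1\cdots y_d$ are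 neighbours iff there are $i\ne j$ such that $x_i\sim y_i$ in $T_i$, $x_j\sim y_j$ in $T_j$, and $x_k=y_k$ for all $k\ne i,j$. $\mathrm{Aff}(\mathbb T_q)$ is the group of all automorphisms of $\mathbb T_q$ that fix $\omega$; for $g\in \mathrm{Aff}(\mathbb T_q)$ the number $\mathfrak h(gx)-\mathfrak h(x)$ does not depend on $x$ and is denoted $\mathfrak h(g)$. Set $\mathcal A(q_1,\dots,q_d)=\{g_1\cdots g_d\in \prod_j\mathrm{Aff}(\mathbb T_{q_j}):\ \mathfrak h(g_1)+\dots+\mathfrak h(g_d)=0\}$, acting on $\mathrm{DL}(q_1,\dots,q_d)$ coordinatewise. A quasi-isometry between metric spaces $(X_1,d_1)$ and $(X_2,d_2)$ is a map $\phi:X_1\to X_2$ for which there are $A>0$, $B\ge0$ with $A^{-1}d_2(\phi x_1,\phi y_1)-B\le d_1(x_1,y_1)\le A\,d_2(\phi x_1,\phi y_1)+B$ for all $x_1,y_1\in X_1$ and $d_2(x_2,\phi X_1)\le B$ for all $x_2\in X_2$. Graphs carry the graph metric. *)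

(* Defs.v *)
From HB Require Import structures.
From mathcomp Require Import all_boot all_order all_algebra.
From mathcomp Require Import all_classical all_reals ereal.

Set Implicit Arguments.
Unset Strict Implicit.
Unset Printing Implicit Defensive.

Import Order.TTheory GRing.Theory Num.Theory.

Local Open Scope classical_set_scope.
Local Open Scope ring_scope.

(* Length of a shortest walk from x to y.  It is the graph metric on connected
   graphs, the only ones considered below (a Diestel-Leader graph with at least
   two factors is connected); the value 0 for unconnected vertices is junk. *)
Definition gdist (V : Type) (e : rel V) (x y : V) : nat :=
  xget 0%N [set n | (exists p, [/\ path e x p, last x p = y & size p = n]) /\
                    (forall p, path e x p -> last x p = y -> (n <= size p)%N)].

Definition is_tree (V : eqType) (e : rel V) : Prop :=
  [/\ symmetric e, irreflexive e,
      forall x y, exists2 p, path e x p & last x p = y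
    & forall c : seq V, cycle e c -> uniq c -> (size c <= 2)%N].

Definition geodesic_ray (V : Type) (e : rel V) (r : nat -> V) : Prop :=
  forall m n, (m <= n)%N -> gdist e (r m) (r n) = (n - m)%N.

Definition ray_equiv (V : Type) (r r' : nat -> V) : Prop :=
  finite_set (range r `+` range r').

Definition is_end (V : Type) (e : rel V) (w : set (nat -> V)) : Prop :=
  exists2 r, geodesic_ray e r &
    w = [set r' | geodesic_ray e r' /\ ray_equiv r r'].

(* The tree T_q with its origin and its end.  This datum is unique up to
   isomorphism, so a statement about all its models is one about T_q. *)
Record homTree (q : nat) := HomTree {
  vertex :> choiceType;
  adj : rel vertex;
  origin : vertex;
  omega : set (nat -> vertex);
  homTree_tree : is_tree adj;
  homTree_deg : forall x : vertex, ([set y | adj x y] #= `I_q.+1)%card;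
  homTree_end : is_end adj omega }.

Arguments adj {q} _ _ _.
Arguments origin {q} _.
Arguments omega {q} _ _.

Section Tree.
Variables (q : nat) (T : homTree q).

Definition tdist (x y : T) : nat := gdist (adj T) x y.

Definition first_common (x y z : T) : Prop :=
  exists rx ry : nat -> T,
    [/\ omega T rx, rx 0%N = x, omega T ry, ry 0%N = y &
        exists m, [/\ rx m = z, range ry z &
                      forall k, (k < m)%N -> ~ range ry (rx k)]].

(* The confluent of x and y; the default value x is never used, since
   first_common x y is a singleton. *)
Definition confluent (x y : T) : T := xget x (first_common x y).

Definition busemann (x : T) : int :=
  (tdist x (confluent x (origin T)))%:Z
  - (tdist (origin T) (confluent x (origin T)))%:Z.

Definition Aff : set (T -> T) :=
  [set g | [/\ bijective g, forall x y, adj T (g x) (g y) = adj T x y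
             & [set g \o r | r in omega T] = omega T]].

(* For g in Aff the difference busemann (g x) - busemann x does not depend
   on x; here it is evaluated at the origin. *)
Definition shift (g : T -> T) : int :=
  busemann (g (origin T)) - busemann (origin T).

End Tree.

Section DiestelLeader.
Variables (d : nat) (q : 'I_d -> nat) (T : forall i, homTree (q i)).

Definition DL : Type :=
  {x : {dffun forall i : 'I_d, T i} | \sum_(i < d) busemann (x i) == 0}.

Definition coords (x : DL) : {dffun forall i : 'I_d, T i} := val x.

Definition DLadj : rel DL := fun x y =>
  [exists i : 'I_d, exists j : 'I_d,
    [&& i != j, adj (T i) (coords x i) (coords y i),
        adj (T j) (coords x j) (coords y j)
      & [forall k : 'I_d,
           (k != i) && (k != j) ==> (coords x k == coords y k)]]].

(* The families g_1 ... g_d of self-maps of the d trees. *)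
Definition treeMaps : Type := forall i : 'I_d, T i -> T i.

Definition maps_id : treeMaps := fun i x => x.

Definition maps_comp (g h : treeMaps) : treeMaps := fun i x => g i (h i x).

Definition maps_act (g : treeMaps) (x : {dffun forall i : 'I_d, T i}) :
    {dffun forall i : 'I_d, T i} := [ffun i => g i (x i)].

Definition DLgroup : set treeMaps :=
  [set g | (forall i, @Aff _ (T i) (g i)) /\
           \sum_(i < d) shift (g i) = 0].

Definition subgroup_DL (G : set treeMaps) : Prop :=
  [/\ G `<=` DLgroup, G maps_id,
      forall g h, G g -> G h -> G (maps_comp g h)
    & forall g, G g ->
        exists2 h, G h & maps_comp g h = maps_id /\ maps_comp h g = maps_id].

Definition level_subgroup (s : nat) (G : set treeMaps) : set treeMaps :=
  [set g | G g /\ forall i, (s%:Z %| shift (g i))%Z].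

Definition DLtransitive (G : set treeMaps) : Prop :=
  forall x y : DL, exists2 g, G g & maps_act g (coords x) = coords y.

Definition DLfree (G : set treeMaps) : Prop :=
  forall (x : DL) g, G g -> maps_act g (coords x) = coords x -> g = maps_id.

End DiestelLeader.

Definition group_embedding (d : nat) (q q' : 'I_d -> nat)
    (T : forall i, homTree (q i)) (T' : forall i, homTree (q' i))
    (G : set (treeMaps T)) (H : set (treeMaps T'))
    (f : treeMaps T -> treeMaps T') : Prop :=
  [/\ forall g, G g -> H (f g),
      forall g h, G g -> G h -> f (maps_comp g h) = maps_comp (f g) (f h)
    & forall g h, G g -> G h -> f g = f h -> g = h].

(* Metrics are passed as functions; the distance to the image is an infimum in
   the extended reals. *)
Definition quasi_isometry (R : realType) (X1 X2 : Type)
    (d1 : X1 -> X1 -> R) (d2 : X2 -> X2 -> R) (phi : X1 -> X2) : Prop :=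
  exists A B : R,
    [/\ 0 < A, 0 <= B,
        forall x y, A^-1 * d2 (phi x) (phi y) - B <= d1 x y /\
                    d1 x y <= A * d2 (phi x) (phi y) + B
      & forall z, (ereal_inf [set (d2 z (phi x))%:E | x in [set: X1]]
                   <= B%:E)%E].

Definition DLdist (R : realType) (d : nat) (q : 'I_d -> nat)
    (T : forall i, homTree (q i)) (x y : DL T) : R :=
  (gdist (@DLadj d q T) x y)%:R.

(* Main.v *)
Require Import Defs.
From mathcomp Require Import all_boot all_order all_algebra.
From mathcomp Require Import all_classical all_reals ereal.
From mathcomp Require Import zify.

(** In a homogeneous tree with a fixed end, let the parent [par x] of a vertex
    be the next vertex on its ray to the end.  Everything is governed by the
    parent map: edges join vertices to their parents ([adjE]), the rays of the
    end are the orbits of [par] ([omegaE]), the height drops by one at each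
    parent ([busemann_iter]), and the affine group consists of the bijections
    that commute with [par] ([AffE]).

    The vertices of [T_q] whose height is divisible by [s], with the [s]-th
    ancestor as parent, form a tree in which every vertex has [q ^ s] children.
    It is therefore a copy of [T_(q^s)]: labelling the children of every vertex,
    with label 0 along the ray of the origin, codes a vertex by its height and
    the eventually zero sequence of labels of its ancestors, and blocks of [s]
    base [q] digits are single base [q ^ s] digits.  This gives an injection
    [psi : T_(q^s) -> T_q] that multiplies heights by [s] and has the level set
    as image ([level_embedding]).  It satisfies
    [tdist x y <= tdist (psi x) (psi y) <= s * tdist x y].

    Applied in each coordinate, these injections define the quasi-isometry.  In
    a Diestel-Leader graph with at least two factors, the distance and the sum
    of the tree distances between coordinates are within a factor 2 of each
    other ([DL_gdist_le], [sum_tdist_le]): when one coordinate moves, another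
    one can compensate its height by descending and later climb back.  So the
    tree estimates carry over, and every vertex is within [d * s] of the image,
    because all coordinates but one can be raised to the level sets and the
    last one then follows ([level_map_dense]).

    An element of the group with shifts divisible by [s] preserves the level
    sets, so it can be conjugated by the injections.  The conjugate determines
    it because each vertex is an ancestor of a vertex of the level set
    ([level_lift_faithful]).  The conjugate acts on the vertices of the small
    graph as the original acts on their images, whence freeness; transitivity
    holds since an element that maps a point of the image to another one has
    shifts divisible by [s]. *)

Set Implicit Arguments.
Unset Strict Implicit.
Unset Printing Implicit Defensive.

Import Order.TTheory GRing.Theory Num.Theory.

Local Open Scope classical_set_scope.
Local Open Scope nat_scope.

(** * Walks and the graph distance *)

Section Walks.
Variables (V : Type) (e : rel V).

Definition walk (n : nat) (x y : V) : Prop :=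
  exists p, [/\ path e x p, last x p = y & size p = n].

Lemma walk0 x : walk 0 x x.
Proof. by exists [::]. Qed.

Lemma walk1 x y : e x y -> walk 1 x y.
Proof. by move=> exy; exists [:: y]; rewrite /= exy. Qed.

Lemma walkD m n x y z : walk m x y -> walk n y z -> walk (m + n) x z.
Proof.
move=> [p [pp lp <-]] [p' [pp' lp' <-]]; exists (p ++ p').
by rewrite cat_path last_cat size_cat pp lp.
Qed.

Lemma walkS n x z : walk n.+1 x z -> exists2 y, e x y & walk n y z.
Proof.
move=> [[|y p] []//= /andP[exy pp] lp [sp]].
by exists y => //; exists p.
Qed.

Lemma walk_sym n x y : symmetric e -> walk n x y -> walk n y x.
Proof.
move=> se; elim: n x => [x [p [_ <- /size0nil ->]]|n IH x /walkS[z exz /IH]].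
  exact: walk0.
by move=> w; rewrite -addn1; apply: walkD w _; apply: walk1; rewrite se.
Qed.

Lemma gdist_spec n x y : walk n x y ->
  walk (gdist e x y) x y /\ gdist e x y <= n.
Proof.
move=> wn.
pose S := [set n | (exists p, [/\ path e x p, last x p = y & size p = n]) /\
                    (forall p, path e x p -> last x p = y -> (n <= size p)%N)].
have exS : exists m, S m.
  have ex : exists m, `[< walk m x y >] by exists n; apply/asboolP.
  case: (ex_minnP ex) => m /asboolP wm mmin; exists m; split=> // p pp lp.
  by apply: mmin; apply/asboolP; exists p.
have [w le] : S (gdist e x y) by exact: (xgetPex 0 exS).
by split=> //; case: wn => p [pp lp <-]; apply: le.
Qed.

Lemma gdist_walk n x y : walk n x y -> walk (gdist e x y) x y.
Proof. by case/gdist_spec. Qed.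

Lemma gdist_le n x y : walk n x y -> gdist e x y <= n.
Proof. by case/gdist_spec. Qed.

End Walks.

Lemma eventually_constant (u : nat -> nat) :
  (forall k, u k.+1 <= u k) -> exists K, forall k, K <= k -> u k = u K.
Proof.
move=> du.
have ex : exists m, `[< exists k, u k = m >] by exists (u 0); apply/asboolP; exists 0.
case: (ex_minnP ex) => m /asboolP[K <-] umin; exists K => k /subnKC <-.
apply/eqP; rewrite eqn_leq umin ?andbT; last by apply/asboolP; exists (K + (k - K)).
elim: (k - K) => [|j IH]; first by rewrite addn0.
by rewrite addnS (leq_trans (du _)).
Qed.

(** * Distances in a tree *)

Section TreeMetric.
Variables (q : nat) (T : homTree q).
Implicit Types x y z v : T.
Local Notation E := (adj T).

Lemma adj_sym : symmetric E. Proof. by case: (homTree_tree T). Qed.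

Lemma adj_irr : irreflexive E. Proof. by case: (homTree_tree T). Qed.

Lemma tdist_walk x y : walk E (tdist x y) x y.
Proof.
have [_ _ conn _] := homTree_tree T; have [p pp lp] := conn x y.
by apply: (@gdist_walk _ _ (size p)); exists p.
Qed.

Lemma tdistxx x : tdist x x = 0.
Proof. by apply/eqP; rewrite -leqn0; apply: gdist_le; apply: walk0. Qed.

Lemma tdist0_eq x y : tdist x y = 0 -> x = y.
Proof.
by have := tdist_walk x y => /[swap] -> [p [_ <- /size0nil ->]].
Qed.

Lemma tdistC x y : tdist x y = tdist y x.
Proof.
by apply/eqP; rewrite eqn_leq !gdist_le //;
  apply: (walk_sym adj_sym); apply: tdist_walk.
Qed.

Lemma tdist_triangle y x z : tdist x z <= tdist x y + tdist y z.
Proof. by apply: gdist_le; apply: walkD; apply: tdist_walk. Qed.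

Lemma tdist_adj x y : E x y -> tdist x y <= 1.
Proof. by move=> exy; apply: gdist_le; apply: walk1. Qed.

Lemma tdist_adjl x y v : E x y -> tdist x v <= (tdist y v).+1.
Proof.
move=> exy; rewrite -add1n (leq_trans (tdist_triangle y _ _)) //.
by rewrite leq_add2r tdist_adj.
Qed.

Lemma closer_neighbour x v : x <> v ->
  exists2 y, E x y & tdist x v = (tdist y v).+1.
Proof.
move=> xv; have := tdist_walk x v; case dxv: (tdist x v) => [|n].
  by move/tdist0_eq: dxv.
case/(@walkS _ E) => y exy w; exists y => //.
apply/eqP; rewrite eqn_leq -{1}dxv tdist_adjl // ltnS.
exact: gdist_le.
Qed.

(** Otherwise a simple path between two distinct neighbours of [x] that avoids
    [x] would close up to a cycle of length at least three through [x]. *)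
Lemma neighbours_separated x y z p : E x y -> E x z ->
  path E y p -> last y p = z -> x \notin y :: p -> y = z.
Proof.
move=> exy exz pp; case/shortenP: pp => p' pp' up' sub lp' xnp.
have [_ _ _ acyc] := homTree_tree T.
case: p' => [|w p'] in pp' up' sub lp' *; first by [].
have cyc : cycle E [:: x, y, w & p'].
  change (path E x (rcons [:: y, w & p'] x)); rewrite rcons_path.
  apply/andP; split; first by apply/andP; split.
  by rewrite [last _ _]lp' adj_sym.
suff : uniq [:: x, y, w & p'] by move/(acyc _ cyc).
apply/andP; split; last exact: up'.
rewrite in_cons in xnp; case/norP: xnp => nxy xnp.
by apply/negP; rewrite in_cons => /orP[|/sub]; apply/negP.
Qed.

(** A geodesic from [y] to [v] has this property: a passage through [x] would
    make [x] strictly closer to [v] than [y] is. *)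
Lemma path_avoiding x y v : E x y -> tdist y v <= tdist x v ->
  exists p, [/\ path E y p, last y p = v & x \notin y :: p].
Proof.
move=> exy le; have [p [pp lp sp]] := tdist_walk y v.
exists p; split=> //; rewrite inE negb_or; apply/andP; split.
  by apply: contraTneq exy => ->; rewrite adj_irr.
apply/negP => xp; case/splitPr: xp pp lp sp => p1 p2.
rewrite cat_path last_cat size_cat /= => /andP[_ /andP[_ pp2]] lp2 sp.
suff dle : tdist x v <= size p2.
  by move: (leq_trans le dle); rewrite -sp; move: (size p1) (size p2); lia.
by apply: gdist_le; exists p2.
Qed.

(** The two geodesics to [v] join [y] to [z] without passing through [x].  So
    exactly one neighbour of [x] is closer to [v], and all others are farther
    away. *)
Lemma closer_unique x y z v : E x y -> E x z ->
  tdist y v <= tdist x v -> tdist z v <= tdist x v -> y = z.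
Proof.
move=> exy exz /(path_avoiding exy)[p [pp lp xp]].
move=> /(path_avoiding exz)[p' [pp' lp' xp']].
apply: (@neighbours_separated x y z (p ++ rev (belast z p'))) => //.
- rewrite cat_path pp lp -lp' rev_path /=.
  by rewrite (@eq_path _ _ E) // => a b; rewrite adj_sym.
- rewrite last_cat lp -lp'; case: p' {pp' lp' xp'} => //= a p'.
  by rewrite rev_cons last_rcons.
- rewrite -cat_cons mem_cat negb_or xp mem_rev /=.
  by apply: contra xp' => /mem_belast.
Qed.

End TreeMetric.

(** * The parent map of a tree with a fixed end *)

Section Parent.
Variables (q : nat) (T : homTree q).
Implicit Types x y z v : T.
Local Notation E := (adj T).

Let r0 : nat -> T := s2val (cid2 (homTree_end T)).

Let r0_geo : geodesic_ray E r0.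
Proof. exact: (s2valP (cid2 (homTree_end T))). Qed.

Let omega_r0 : omega T = [set r | geodesic_ray E r /\ ray_equiv r0 r].
Proof. exact: (s2valP' (cid2 (homTree_end T))). Qed.

Let r0_dist m n : m <= n -> tdist (r0 m) (r0 n) = n - m.
Proof. exact: r0_geo. Qed.

(** The first step from [x] on its ray to the end: the neighbour that is
    eventually closer to the points of the reference ray. *)
Definition toward x y : Prop :=
  E x y /\ exists K, forall k, K <= k -> tdist x (r0 k) = (tdist y (r0 k)).+1.

Definition par x : T := xget x [set y | toward x y].

(** The triangle inequalities make [tdist x (r0 k) - k] nonincreasing and
    bounded below, hence eventually constant. *)
Lemma tdist_ray_growth x : exists K, forall j,
  tdist x (r0 (K + j)) = tdist x (r0 K) + j.
Proof.
have lb k : k <= tdist x (r0 k) + tdist x (r0 0).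
  by rewrite addnC (tdistC x) -{1}[k]subn0 -r0_dist // tdist_triangle.
have st k : tdist x (r0 k.+1) <= (tdist x (r0 k)).+1.
  by rewrite (leq_trans (tdist_triangle (r0 k) _ _)) // r0_dist // subSnn addn1.
have [|K uK] := @eventually_constant
    (fun k => tdist x (r0 k) + tdist x (r0 0) - k).
  by move=> k; move: (lb k) (lb k.+1) (st k); lia.
exists K => j; have := uK (K + j) (leq_addr _ _).
by move: (lb K) (lb (K + j)); lia.
Qed.

Lemma toward_exists x : exists y, toward x y.
Proof.
have [K gK] := tdist_ray_growth x.
have xr : x <> r0 K.+1.
  by move=> xr; have := gK 1; rewrite addn1 -xr tdistxx; lia.
have [y exy dy] := closer_neighbour xr.
exists y; split=> //; exists K.+1 => k /subnKC <-.
move: (k - K.+1) => j; apply/eqP; rewrite eqn_leq tdist_adjl //=.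
have := tdist_triangle (r0 K.+1) y (r0 (K.+1 + j)).
rewrite r0_dist ?leq_addr // addKn.
by have := gK 1; have := gK j.+1; rewrite addn1 addSn addnS; lia.
Qed.

Lemma par_toward x : toward x (par x).
Proof. exact: xgetPex (toward_exists x). Qed.

Lemma adj_par x : E x (par x).
Proof. by case: (par_toward x). Qed.

(** A neighbour that is infinitely often no farther from the reference ray
    competes with the parent at some point of that ray, where the closer
    neighbour is unique. *)
Lemma par_unique x y : E x y ->
  (forall K, exists2 k, K <= k & tdist y (r0 k) <= tdist x (r0 k)) -> y = par x.
Proof.
move=> exy cof; have [exp [K pK]] := par_toward x.
have [k Kk le] := cof K.
by apply: (closer_unique exy exp le); rewrite pK.
Qed.

Lemma par_r0 n : par (r0 n) = r0 n.+1.
Proof.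
apply/esym/par_unique.
  have := tdist_walk (r0 n) (r0 n.+1); rewrite r0_dist // subSnn.
  by case/(@walkS _ E) => y e [p [_ <- /size0nil ->]].
move=> K; exists (K + n.+1); first exact: leq_addr.
by rewrite !r0_dist; lia.
Qed.

Lemma iter_par_r0 m n : iter m par (r0 n) = r0 (m + n).
Proof. by elim: m => //= m ->; rewrite par_r0. Qed.

(** Once the distance to the reference ray grows by one at each step, the
    geodesic from [x] to the ray point [r0 K] is made of parents, because the
    same neighbour is closer to all later points. *)
Lemma iter_par_meets_r0 x : exists m n, iter m par x = r0 n.
Proof.
have [K] := tdist_ray_growth x.
move: (tdist x (r0 K)) => D; elim: D x => [|D IH] x gx.
  by exists 0, K; apply/tdist0_eq; have := gx 0; rewrite addn0.
have xr : x <> r0 K.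
  by move=> xr; have := gx 0; rewrite addn0 xr tdistxx.
have [y exy dy] := closer_neighbour xr.
have gy j : tdist y (r0 (K + j)) = D + j.
  apply/eqP; rewrite eqn_leq; apply/andP; split.
    have := tdist_triangle (r0 K) y (r0 (K + j)).
    by rewrite r0_dist ?leq_addr // addKn; have := gx 0; rewrite addn0; lia.
  by have := tdist_adjl (r0 (K + j)) exy; rewrite gx; lia.
have [m [n mn]] := IH y gy; exists m.+1, n; rewrite iterSr -mn.
congr (iter _ _ _); apply/esym/par_unique => // L; exists (K + L); first exact: leq_addl.
by rewrite gx gy; lia.
Qed.

Lemma iter_par_dist n x :
  exists K, forall k, K <= k ->
    tdist x (r0 k) = tdist (iter n par x) (r0 k) + n.
Proof.
elim: n => [|n [K IH]] /=; first by exists 0 => k _; rewrite addn0.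
have [_ [L pL]] := par_toward (iter n par x).
exists (maxn K L) => k; rewrite geq_max => /andP[Kk Lk].
by rewrite IH // pL // addSnnS.
Qed.

Lemma walk_iter_par n x : walk E n x (iter n par x).
Proof.
elim: n => [|n IH]; first exact: walk0.
by rewrite -{1}[n.+1]addn1; apply: (walkD IH); apply: walk1; apply: adj_par.
Qed.

Lemma tdist_iter_par n x : tdist x (iter n par x) = n.
Proof.
apply/eqP; rewrite eqn_leq (gdist_le (walk_iter_par n x)) /=.
have [K /(_ K (leqnn K))] := iter_par_dist n x.
by have := tdist_triangle (iter n par x) x (r0 K); lia.
Qed.

Lemma iter_par_inj x : injective (fun n => iter n par x).
Proof.
move=> m n /= eq.
by rewrite -[m](tdist_iter_par m x) -[n in RHS](tdist_iter_par n x) eq.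
Qed.

(** By [par_unique], a neighbour other than the parent is eventually farther from
    the points of the reference ray than [x] is, so [x] is its parent. *)
Lemma adjE x y : E x y = (y == par x) || (x == par y).
Proof.
apply/idP/idP => [exy|/orP[]/eqP->]; last 2 first.
- exact: adj_par.
- by rewrite adj_sym adj_par.
have [//|/eqP ny] := eqVneq y (par x).
apply/orP; right; apply/eqP; apply: par_unique; first by rewrite adj_sym.
move=> K; have [k Kk lt] : exists2 k, K <= k & ~ (tdist y (r0 k) <= tdist x (r0 k)).
  apply: contrapT => no; apply: ny; apply: par_unique => // L.
  exists (maxn K L); first exact: leq_maxr.
  by apply: contrapT => nle; apply: no; exists (maxn K L); first exact: leq_maxl.
by exists k => //; move: lt; lia.
Qed.

Lemma injective_leaves_finite (r : nat -> T) (A : set T) :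
  injective r -> finite_set A -> exists K, forall k, K <= k -> ~ A (r k).
Proof.
move=> ri /finite_seqP[s ->]; elim: s => [|a s [K IH]]; first by exists 0.
have [[k0 rk0]|no] := pselect (exists k0, r k0 = a).
  exists (maxn K k0.+1) => k; rewrite geq_max => /andP[/IH ns lt] /=.
  by rewrite in_cons -rk0 => /orP[/eqP/ri eqk|//]; move: lt; rewrite eqk ltnn.
exists K => k /IH ns /=; rewrite in_cons => /orP[/eqP rk|//].
by apply: no; exists k.
Qed.

Lemma geodesic_ray_inj r : geodesic_ray E r -> injective r.
Proof.
move=> gr m n eqr; wlog mn : m n eqr / m <= n.
  by move=> H; case/orP: (leq_total m n) => [/(H _ _ eqr)|/(H _ _ (esym eqr))].
have := gr m n mn; rewrite eqr; have := tdistxx (r n); rewrite /tdist => ->; lia.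
Qed.

(** The reference ray lies in the range of [r] up to finitely many points, and
    it eventually leaves the finite set [r 0, ..., r n]; so its far points are
    points [r j] with [j > n], to which [r n.+1] is closer than [r n]. *)
Lemma omega_par r : omega T r -> forall n, r n.+1 = par (r n).
Proof.
rewrite omega_r0 => -[gr eqv] n; apply: par_unique.
  have := tdist_walk (r n) (r n.+1); rewrite /tdist gr // subSnn.
  by case/(@walkS _ E) => y e [p [_ <- /size0nil ->]].
move=> K.
pose A := (range r0 `+` range r) `|` r @` `I_n.+1.
have finA : finite_set A.
  by rewrite finite_setU; split=> //; apply: finite_image; apply: finite_II.
have [L HL] := injective_leaves_finite (geodesic_ray_inj r0_geo) finA.
exists (maxn K L); first exact: leq_maxl.
have /HL : L <= maxn K L by exact: leq_maxr.
move: (maxn K L) => k nA.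
have [j _ rj] : range r (r0 k).
  by apply: contrapT => nr; apply: nA; left; left; split=> //; exists k.
have nj : n < j.
  by rewrite ltnNge; apply/negP => jn; apply: nA; right; exists j => //=.
rewrite -rj /tdist !gr //; last exact: ltnW.
by lia.
Qed.

Lemma omega_iter_par x : omega T (fun n => iter n par x).
Proof.
rewrite omega_r0; split=> [m n mn|].
  rewrite -{1}(subnK mn) iterD; exact: tdist_iter_par.
have [m [n mn]] := iter_par_meets_r0 x.
have tail k : iter (k + m) par x = r0 (k + n) by rewrite iterD mn iter_par_r0.
apply: (@sub_finite_set _ _ (r0 @` `I_n `|` (fun k => iter k par x) @` `I_m)).
  move=> y [[[k _ <-] ny]|[[k _ <-] ny]].
    left; exists k => //=; rewrite ltnNge; apply/negP => /subnK kn.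
    by apply: ny; exists (k - n + m) => //; rewrite tail kn.
  right; exists k => //=; rewrite ltnNge; apply/negP => /subnK km.
  by apply: ny; exists (k - m + n) => //; rewrite -tail km.
by rewrite finite_setU; split; apply: finite_image; apply: finite_II.
Qed.

(** The end is recovered from the parent map alone, so every notion defined
    through it, such as the confluent or the affine group, can be expressed by
    parents. *)
Lemma omegaE r : omega T r <-> forall n, r n.+1 = par (r n).
Proof.
split=> [/omega_par//|rS].
suff -> : r = fun n => iter n par (r 0) by exact: omega_iter_par.
by apply/funext; elim=> //= n <-; apply: rS.
Qed.

Lemma iter_par_confluent x y : exists m n, iter m par x = iter n par y.
Proof.
have [m [n mn]] := iter_par_meets_r0 x; have [m' [n' mn']] := iter_par_meets_r0 y.
by exists (n' + m), (n + m'); rewrite !iterD mn mn' !iter_par_r0 addnC.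
Qed.

Lemma iter_par_shift x y m n m' n' :
  iter m par x = iter n par y -> iter m' par x = iter n' par y -> m + n' = m' + n.
Proof.
wlog mm : m n m' n' / m <= m'.
  move=> H e e'; have [le|/ltnW le] := leqP m m'; [exact: H|exact/esym/H].
move=> e; rewrite -{1}(subnK mm) iterD e -iterD => /iter_par_inj.
by lia.
Qed.

(** The defining confluent is the first common iterated parent; any other
    common iterated parent adds the same amount to both exponents. *)
Lemma busemannE x m n : iter m par x = iter n par (origin T) ->
  busemann x = (m%:Z - n%:Z)%R.
Proof.
move=> mn.
suff [m0 [n0 [e0 <-]]] : exists m0 n0, iter m0 par x = iter n0 par (origin T) /\
    (m0%:Z - n0%:Z)%R = busemann x.
  by have := iter_par_shift mn e0; lia.
(* The least [k] here gives the confluent. *)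
have ex : exists k, `[< range (fun n => iter n par (origin T)) (iter k par x) >].
  by exists m; apply/asboolP; exists n.
have fc : exists z, first_common x (origin T) z.
  case: (ex_minnP ex) => m0 /asboolP rm0 min0.
  exists (iter m0 par x), (fun n => iter n par x), (fun n => iter n par (origin T)).
  split=> //; try exact: omega_iter_par.
  exists m0; split=> // k km0 rk; suff : m0 <= k by rewrite leqNgt km0.
  by apply: min0; apply/asboolP.
have [rx [ry [/omegaE orx rx0 /omegaE ory ry0 [m0 [zm0 [n0 _ zn0] _]]]]] :=
  xgetPex x fc.
have rxE k : rx k = iter k par x by elim: k => //= k <-.
have ryE k : ry k = iter k par (origin T) by elim: k => //= k <-.
exists m0, n0; split; first by rewrite -rxE -ryE zm0 zn0.
rewrite /busemann /confluent -{1}zm0 -zn0 rxE ryE.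
by rewrite !tdist_iter_par.
Qed.

Lemma busemann_iter n x : busemann (iter n par x) = (busemann x - n%:Z)%R.
Proof.
have [m [k mk]] := iter_par_confluent x (origin T).
have e : iter m par (iter n par x) = iter (n + k) par (origin T).
  by rewrite -iterD addnC !iterD mk.
by rewrite (busemannE mk) (busemannE e); lia.
Qed.

Lemma busemann_origin : busemann (origin T) = 0%R.
Proof. by rewrite (@busemannE _ 0 0). Qed.

Lemma same_height_confluent x y : busemann x = busemann y ->
  exists n, iter n par x = iter n par y.
Proof.
move=> h; have [m [n mn]] := iter_par_confluent x y; exists m; rewrite mn.
congr (iter _ _ _); have := congr1 (@busemann q T) mn.
by rewrite !busemann_iter h; lia.
Qed.

(** Each edge of a walk goes to a parent or to a child, and a step down followed
    by a step up cancels, which leaves a climb followed by a descent. *)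
Lemma walk_confluent k x y : walk E k x y ->
  exists m n, m + n <= k /\ iter m par x = iter n par y.
Proof.
elim: k x => [|k IH] x; first by move=> [p [_ <- /size0nil ->]]; exists 0, 0.
case/(@walkS _ E) => x'; rewrite adjE => /orP[]/eqP-> /IH[m [n [le mn]]].
  by exists m.+1, n; rewrite iterSr mn.
case: m le mn => [|m] le mn; first by exists 0, n.+1; rewrite /= -mn.
by exists m, n; rewrite iterSr in mn; split=> //; lia.
Qed.

Lemma tdist_confluent x y :
  exists m n, m + n <= tdist x y /\ iter m par x = iter n par y.
Proof. exact/walk_confluent/tdist_walk. Qed.

Lemma tdist_le m n x y : iter m par x = iter n par y -> tdist x y <= m + n.
Proof.
move=> mn; apply: gdist_le; apply: (walkD (walk_iter_par m x)); rewrite mn.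
exact: walk_sym (@adj_sym _ T) (walk_iter_par n y).
Qed.

Lemma AffE (g : T -> T) :
  Aff g <-> bijective g /\ forall x, g (par x) = par (g x).
Proof.
split=> [[bg _ og]|[bg gp]].
  split=> // x; suff /omega_par/(_ 0) : omega T (g \o fun n => iter n par x) by [].
  rewrite -og.
  by exists (fun n => iter n par x) => //; apply: omega_iter_par.
have [f gK fK] := bg; have fp x : f (par x) = par (f x).
  by apply: (can_inj gK); rewrite gp !fK.
split=> //.
  by move=> x y; rewrite !adjE -!gp !(inj_eq (can_inj gK)).
apply/seteqP; split=> [_ [r /omegaE or <-]|r /omegaE or].
  by apply/omegaE => n /=; rewrite or gp.
exists (f \o r); first by apply/omegaE => n /=; rewrite or fp.
by apply/funext => n /=; rewrite fK.
Qed.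

Lemma Aff_iter_par (g : T -> T) n x : Aff g -> g (iter n par x) = iter n par (g x).
Proof. by case/AffE => _ gp; elim: n => //= n <-. Qed.

Lemma busemann_Aff (g : T -> T) x : Aff g ->
  busemann (g x) = (busemann x + shift g)%R.
Proof.
move=> ag; have [m [n mn]] := iter_par_confluent x (origin T).
have := congr1 (@busemann q T \o g) mn; have := congr1 (@busemann q T) mn.
rewrite /= !(Aff_iter_par _ _ ag) !busemann_iter /shift; lia.
Qed.

End Parent.

Arguments par {q T} x.

(** * Coding vertices by the labels of their ancestors *)

Section Labels.
Variables (q : nat) (T : homTree q).
Implicit Types x y : T.
Local Notation o := (origin T).

Lemma children_list x : exists s : seq T,
  [/\ uniq s, size s = q & forall y, (y \in s) = (par y == x)].
Proof.
have deg := homTree_deg x.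
have fin : finite_set [set y | adj T x y].
  by exists q.+1.
pose F : seq T := finmap.enum_fset (fset_set [set y | adj T x y]).
have sz : size F = q.+1 := card_fset_set deg.
have uF : uniq F := finmap.fset_uniq _.
have memF y : (y \in F) = adj T x y.
  by apply: (etrans (in_fset_set fin y)); apply/idP/idP; rewrite inE.
have nb : par (par x) != x.
  by apply/eqP => /(@iter_par_inj _ T x 2 0).
exists (rem (par x) F); split; first by rewrite rem_uniq.
  by rewrite size_rem ?memF ?adj_par // sz.
move=> y; rewrite (mem_rem_uniq _ uF) inE memF adjE.
have [->|_] := eqVneq y (par x); first by rewrite (negbTE nb).
by rewrite eq_sym.
Qed.

(** The child on the ray of the origin can be put first; then that whole ray
    carries the label 0, and codes are eventually 0. *)
Lemma spine_children_list x : exists s : seq T,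
  [/\ uniq s, size s = q, forall y, (y \in s) = (par y == x)
    & forall n, par (iter n par o) = x -> index (iter n par o) s = 0].
Proof.
have [s [us ss ms]] := children_list x.
have [[n nx]|no] := pselect (exists n, par (iter n par o) = x); last first.
  by exists s; split=> // n nx; case: no; exists n.
have ns : iter n par o \in s by rewrite ms nx.
have pe := perm_to_rem ns.
exists (iter n par o :: rem (iter n par o) s); split.
- by rewrite -(perm_uniq pe).
- by rewrite -(perm_size pe).
- by move=> y; rewrite -(perm_mem pe).
- move=> m mx; have -> : m = n; last by rewrite /= eqxx.
  by have /iter_par_inj [] : iter m.+1 par o = iter n.+1 par o by rewrite /= mx nx.
Qed.

Definition children x : seq T := projT1 (cid (spine_children_list x)).

Lemma childrenP x : [/\ uniq (children x), size (children x) = q,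
  forall y, (y \in children x) = (par y == x)
  & forall n, par (iter n par o) = x -> index (iter n par o) (children x) = 0].
Proof. exact: (projT2 (cid (spine_children_list x))). Qed.

Definition label y : nat := index y (children (par y)).

Lemma label_lt y : label y < q.
Proof.
have [_ sz mem _] := childrenP (par y).
by rewrite -[X in _ < X]sz index_mem mem.
Qed.

Lemma label_inj x y : par x = par y -> label x = label y -> x = y.
Proof.
move=> pxy; rewrite /label -pxy; have [_ _ mem _] := childrenP (par x) => eq.
by apply: (@index_inj _ x (children (par x))) eq; rewrite mem ?pxy.
Qed.

Definition child x : T := nth o (children x) 0.

Lemma iter_par_child n x : 0 < q -> iter n par (iter n child x) = x.
Proof.
move=> q0; have pc y : par (child y) = y.
  by have [_ sz mem _] := childrenP y; apply/eqP; rewrite -mem mem_nth // sz.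
by elim: n => // n IH; rewrite iterSr /= pc.
Qed.

Lemma busemann_child n x : 0 < q ->
  busemann (iter n child x) = (busemann x + n%:Z)%R.
Proof.
move=> q0; have := busemann_iter n (iter n child x).
by rewrite iter_par_child // => ->; lia.
Qed.

Lemma label_onto x c : c < q -> exists2 y, par y = x & label y = c.
Proof.
have [un sz mem _] := childrenP x; rewrite -[X in _ < X]sz => cq.
have px : par (nth o (children x) c) = x.
  by apply/eqP; rewrite -mem mem_nth.
by exists (nth o (children x) c) => //; rewrite /label px index_uniq.
Qed.

Lemma label_origin n : label (iter n par o) = 0.
Proof. by have [_ _ _] := childrenP (par (iter n par o)); apply. Qed.

(** The labels of [x] and of its next [s - 1] ancestors, read as the base [q]
    digits of a number below [q ^ s]: this is the label of [x] among the
    [q ^ s] descendants [s] generations below [iter s par x]. *)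
Fixpoint labels s x : nat :=
  if s is s'.+1 then label x + q * labels s' (par x) else 0.

Lemma labels_lt s x : labels s x < q ^ s.
Proof.
elim: s x => [|s IH] x /=; first by rewrite expn0.
by rewrite expnS; move: (label_lt x) (IH (par x)); nia.
Qed.

Lemma labels_inj s x y :
  iter s par x = iter s par y -> labels s x = labels s y -> x = y.
Proof.
elim: s x y => [//|s IH] x y; rewrite !iterSr /= => pxy lxy.
have q0 : 0 < q by apply: leq_ltn_trans (label_lt x).
apply: label_inj.
  apply: (IH _ _ pxy); have := congr1 (divn^~ q) lxy.
  by rewrite ![_ + q * _]addnC ![q * _]mulnC !divnMDl // !divn_small ?label_lt // !addn0.
have := congr1 (modn^~ q) lxy.
by rewrite ![_ + q * _]addnC ![q * _]mulnC !modnMDl !modn_small ?label_lt.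
Qed.

Lemma labels_onto s x c : c < q ^ s -> exists2 y, iter s par y = x & labels s y = c.
Proof.
elim: s c => [|s IH] c.
  by rewrite expn0 ltnS leqn0 => /eqP->; exists x.
rewrite expnS => cq; have q0 : 0 < q by case: (q) cq.
have [|z zx lz] := IH (c %/ q); first by rewrite ltn_divLR // mulnC.
have [|y py ly] := @label_onto z (c %% q); first by rewrite ltn_mod.
exists y; first by rewrite iterSr py.
by rewrite /= ly py lz mulnC addnC -divn_eq.
Qed.

Lemma labels_origin s n : labels s (iter n par o) = 0.
Proof.
elim: s n => //= s IH n; rewrite label_origin.
by have /= -> := IH n.+1; rewrite muln0.
Qed.

Lemma iter_par_labels_inj s n x y :
  iter (s * n) par x = iter (s * n) par y ->
  (forall i, labels s (iter (s * i) par x) = labels s (iter (s * i) par y)) ->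
  x = y.
Proof.
elim: n x y => [|n IH] x y; first by rewrite muln0.
rewrite mulnS addnC !iterD => eq lab; apply: (@labels_inj s); last first.
  by have := lab 0; rewrite muln0.
by apply: IH => // i; have := lab i.+1; rewrite mulnS addnC !iterD.
Qed.

(** The meeting point with the ray of the origin may be pushed up, here to the
    [s * m]-th ancestor; the divisibility of the height then forces the number
    of steps from the origin to be a multiple of [s] too. *)
Lemma multiple_levels_to_spine s x : 0 < s -> (s %| busemann x)%Z ->
  exists m n, iter (s * m) par x = iter (s * n) par o.
Proof.
move=> s0 /dvdzP[k hx]; have [m [n mn]] := iter_par_confluent x o.
have e : iter (s * m) par x = iter ((s * m - m) + n) par o.
  by rewrite iterD -mn -iterD subnK // leq_pmull.
exists m, (absz (m%:Z - k)%R); rewrite e; congr (iter _ _ _).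
have := busemannE e; rewrite hx => ks.
have : ((s * m - m + n)%N%:Z = s%:Z * (m%:Z - k))%R.
  by rewrite mulrBr [(s%:Z * k)%R]mulrC ks PoszM; lia.
by move=> /(congr1 absz); rewrite abszM /=.
Qed.

End Labels.

Arguments child {q T} x.

(** * Vertices with equal codes in two trees *)

Section Correspondence.
Variables (q q' a a' : nat) (T : homTree q) (T' : homTree q').

(** The graph of the isomorphism between the trees of levels of [T] and [T'] with
    level sizes [a] and [a'] that matches the rays of the two origins. *)
Definition corr (x : T) (x' : T') : Prop :=
  (exists k : int, busemann x = k * a%:Z /\ busemann x' = k * a'%:Z)%R /\
  forall n, labels a (iter (a * n) par x) = labels a' (iter (a' * n) par x').

(** Two vertices of equal height have a common ancestor, from which the labels
    lead down to a single vertex. *)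
Lemma corr_inj x y x' : 0 < a -> 0 < a' -> corr x x' -> corr y x' -> x = y.
Proof.
move=> a_gt0 a0 [[k [hx hx']] lx] [[l [hy hy']] ly].
have kl : k = l by move: hy'; rewrite hx' => /mulIf; apply; case: (a') a0.
have [|n xy] := @same_height_confluent _ T x y; first by rewrite hx hy kl.
apply: (@iter_par_labels_inj _ _ a n) => [|i]; last by rewrite lx ly.
by rewrite -(subnK (leq_pmull n a_gt0)) !iterD xy.
Qed.

Lemma corr_par x x' : corr x x' -> corr (iter a par x) (iter a' par x').
Proof.
move=> [[k [hx hx']] lx]; split=> [|n].
  by exists (k - 1)%R; rewrite !busemann_iter hx hx' !mulrBl !mul1r.
by have := lx n.+1; rewrite !mulnS ![_ + _ * _]addnC !iterD.
Qed.

Lemma corr_spine n : corr (iter (a * n) par (origin T)) (iter (a' * n) par (origin T')).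
Proof.
split=> [|i]; last by rewrite -!iterD !labels_origin.
by exists (- n%:Z)%R; rewrite !busemann_iter !busemann_origin !sub0r !PoszM !mulNr
  ![(n%:Z * _)%R]mulrC.
Qed.

Hypothesis same_degree : q ^ a = q' ^ a'.

Lemma corr_child x y' : corr (iter a par x) y' ->
  exists2 x', iter a' par x' = y' & corr x x'.
Proof.
move=> [[k [hx hy']] lx].
have [|x' px' lx'] := @labels_onto _ T' a' y' (labels a x).
  by rewrite -same_degree labels_lt.
exists x' => //; split=> [|[|n]]; last 2 first.
- by rewrite !muln0 /= lx'.
- by have := lx n; rewrite -px' -!iterD ![_ * n + _]addnC -!mulnS.
exists (k + 1)%R; move: hx hy'; rewrite -px' !busemann_iter !mulrDl !mul1r.
by split; lia.
Qed.

(** Start from the origin rays, which correspond to each other, at an ancestor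
    of [x], and descend one level at a time. *)
Lemma corr_total x : 0 < a -> (a %| busemann x)%Z -> exists x', corr x x'.
Proof.
move=> a0 /(multiple_levels_to_spine a0)[m [n mn]].
have : exists y', corr (iter (a * m) par x) y'.
  by rewrite mn; eexists; apply: corr_spine.
elim: m {mn} => [|m IH]; first by rewrite muln0.
by rewrite mulnS iterD => -[y' /corr_child[x' _ c]]; apply: IH; exists x'.
Qed.

End Correspondence.

Lemma corr_sym q q' a a' (T : homTree q) (T' : homTree q') (x : T) (x' : T') :
  corr a a' x x' -> corr a' a x' x.
Proof. by move=> [[k [h h']] l]; split=> // ; exists k. Qed.

(** The vertices of [T] whose height is divisible by [s] form, with the [s]-th
    ancestor as parent, a tree in which every vertex has [q ^ s] children.  The
    isomorphism with [Ts] sends a vertex to the one with the same code, where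
    [Ts] is read with levels of size 1 and [T] with levels of size [s]. *)
Lemma level_embedding q s (T : homTree q) (Ts : homTree (q ^ s)) : 0 < s ->
  exists psi : Ts -> T,
    [/\ injective psi, forall x, psi (par x) = iter s par (psi x),
        forall x, (busemann (psi x) = busemann x * s%:Z)%R
      & forall y, (s %| busemann y)%Z -> exists x, psi x = y].
Proof.
move=> s0; have card : (q ^ s) ^ 1 = q ^ s by rewrite expn1.
have tot (x : Ts) : exists y : T, corr 1 s x y.
  by apply: corr_total; rewrite ?dvd1z.
have psiP x := projT2 (cid (tot x)).
exists (fun x => projT1 (cid (tot x))); split.
- by move=> x y eq; apply: corr_inj (ltn0Sn 0) s0 (psiP x) _; rewrite eq; apply: psiP.
- move=> x; apply: (@corr_inj _ _ s 1 _ _ _ _ (par x)) => //.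
    exact/corr_sym/psiP.
  exact/corr_sym/(corr_par (psiP x)).
- by move=> x; have [[k [-> ->]] _] := psiP x; rewrite mulr1.
- move=> y /(corr_total Ts (esym card) s0)[x xy]; exists x.
  exact: corr_inj s0 (ltn0Sn 0) (corr_sym (psiP x)) xy.
Qed.

(** * The level set of a tree *)

Lemma level_below s (z : int) : 0 < s -> exists2 n, n < s & (s %| (z - n%:Z)%R)%Z.
Proof.
move=> s_gt0; have s0 : s%:Z%R != 0%R by rewrite eqz_nat -lt0n.
have e : (absz (z %% s)%Z)%:Z%R = (z %% s)%Z by rewrite gez0_abs // modz_ge0.
exists (absz (z %% s)%Z); first by rewrite -ltz_nat e ltz_pmod // ltz_nat.
by rewrite e {1}(divz_eq z s) addrK dvdz_mull.
Qed.

Section Level.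
Variables (q q' s : nat) (T : homTree q) (Ts : homTree q') (psi : Ts -> T).
Hypotheses (s_gt0 : 0 < s) (psi_inj : injective psi)
  (psi_par : forall x, psi (par x) = iter s par (psi x))
  (psi_height : forall x, (busemann (psi x) = busemann x * s%:Z)%R)
  (psi_onto : forall y, (s %| busemann y)%Z -> exists x, psi x = y).

Lemma level_iter_par n x : psi (iter n par x) = iter (s * n) par (psi x).
Proof.
by elim: n => [|n IH]; rewrite ?muln0 //= psi_par IH -iterD mulnS.
Qed.

Lemma level_tdist_le x y : tdist (psi x) (psi y) <= s * tdist x y.
Proof.
have [m [n [le mn]]] := tdist_confluent x y.
apply: (@leq_trans (s * m + s * n)); last by rewrite -mulnDr leq_mul2l le orbT.
by apply: tdist_le; rewrite -!level_iter_par mn.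
Qed.

Lemma tdist_le_level x y : tdist x y <= tdist (psi x) (psi y).
Proof.
have [m [n [le mn]]] := tdist_confluent (psi x) (psi y).
have := congr1 (@busemann q T) mn; rewrite !busemann_iter !psi_height => hmn.
(* Round the meeting point of the two rays up to the next level: [s * M] and
   [s * N] exceed [m] and [n] by the same [r < s]. *)
pose M := (m + s.-1) %/ s; pose r := s * M - m.
have [mM Mm] : m <= s * M /\ s * M < m + s.
  have := divn_eq (m + s.-1) s; rewrite -/M; have := ltn_pmod (m + s.-1) s_gt0.
  by rewrite mulnC; move: s_gt0; lia.
pose N := absz (M%:Z - (busemann x - busemann y))%R.
have sN : s * N = r + n.
  suff : (s%:Z * (M%:Z - (busemann x - busemann y)) = (r + n)%N%:Z)%R.
    by move=> /(congr1 absz); rewrite abszM.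
  by rewrite /r; move: mM hmn; nia.
have small k l : s * k < l + s -> k <= l.
  move=> kl; rewrite leqNgt; apply/negP => lk.
  move: kl; rewrite ltnNge => /negP; apply.
  by rewrite (leq_trans _ (leq_mul (leqnn s) lk)) //
    mulnS [s + _]addnC leq_add2r leq_pmull.
apply: (@leq_trans (M + N)); last first.
  apply: leq_trans le; apply: leq_add; apply: small; first exact: Mm.
  rewrite sN [r + n]addnC ltn_add2l /r.
  by move: Mm mM; move: (s * M); clear; lia.
apply: tdist_le; apply: psi_inj; rewrite !level_iter_par sN.
by rewrite -(subnK mM) !iterD mn.
Qed.

(** The conjugate of [g] by [psi]; it is meaningful when [g] preserves the level
    set, and the default value [x] is arbitrary otherwise. *)
Definition level_lift (g : T -> T) (x : Ts) : Ts := xget x [set y | psi y = g (psi x)].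

Section Lift.
Variable g : T -> T.
Hypotheses (g_Aff : Aff g) (g_shift : (s %| shift g)%Z).

Lemma level_shift y : (s %| busemann (g y))%Z = (s %| busemann y)%Z.
Proof. by rewrite busemann_Aff // rpredDr. Qed.

Lemma liftP x : psi (level_lift g x) = g (psi x).
Proof.
apply: (@xgetPex _ x [set y | psi y = g (psi x)]); apply: psi_onto.
by rewrite level_shift psi_height dvdz_mull.
Qed.

Lemma Aff_lift : Aff (level_lift g).
Proof.
have [[f gK fK] gp] := (AffE g).1 g_Aff; apply/AffE; split; last first.
  move=> x; apply: psi_inj; rewrite liftP !psi_par liftP.
  exact: Aff_iter_par.
have onto y : exists x, level_lift g x = y.
  have [|x xy] := @psi_onto (f (psi y)).
    by rewrite -level_shift fK psi_height dvdz_mull.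
  by exists x; apply: psi_inj; rewrite liftP xy fK.
have [h hK] := choice onto; exists h => // x; apply: psi_inj.
by apply: (can_inj gK); rewrite -!liftP hK.
Qed.

Lemma shift_lift : (shift (level_lift g) * s%:Z = shift g)%R.
Proof.
have := busemann_Aff (psi (origin Ts)) g_Aff; rewrite -liftP !psi_height.
by rewrite (busemann_Aff (origin Ts) Aff_lift) mulrDl => /addrI.
Qed.

End Lift.

(** The lift determines [g] on the level set, hence everywhere, since every
    vertex is an ancestor of a vertex of the level set and [g] commutes with
    parents. *)
Lemma level_lift_faithful g h : 0 < q -> Aff g -> Aff h ->
  (s %| shift g)%Z -> (s %| shift h)%Z ->
  level_lift g = level_lift h -> g = h.
Proof.
move=> q_gt0 ag ah sg sh eq; apply/funext => y.
have [n _ dn] := level_below (- busemann y)%R s_gt0.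
have [|x xy] := @psi_onto (iter n child y).
  by rewrite busemann_child // -rpredN opprD.
rewrite -[y](iter_par_child n) // -xy !Aff_iter_par //.
by rewrite -(liftP ag sg) -(liftP ah sh) eq.
Qed.

End Level.

(** * Distances in a Diestel-Leader graph *)

Section DLMetric.
Variables (d : nat) (q : 'I_d -> nat) (T : forall i, homTree (q i)).
Hypothesis q_gt0 : forall i, 0 < q i.
Implicit Types x y z : DL T.

Lemma DL_height x : (\sum_(i < d) busemann (coords x i) = 0)%R.
Proof. exact/eqP/(valP x). Qed.

Lemma DL_height_sub (w : 'I_d -> nat) x :
  (\sum_i (busemann (coords x i) - (w i)%:Z) = - (\sum_i w i)%:Z)%R.
Proof. by rewrite sumrB DL_height sub0r (big_morph Posz PoszD (erefl _)). Qed.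

Lemma DL_ext x y : (forall i, coords x i = coords y i) -> x = y.
Proof. by move=> xy; apply/val_inj/ffunP. Qed.

Lemma DL_mk (F : forall i, T i) : (\sum_(i < d) busemann (F i) = 0)%R ->
  exists x, forall i, coords x i = F i.
Proof.
move=> sF; pose G : {dffun forall i : 'I_d, T i} := [ffun i => F i].
have h : (\sum_(i < d) busemann (G i) == 0)%R.
  by apply/eqP; rewrite -[RHS]sF; apply: eq_bigr => i _; rewrite ffunE.
by exists (exist _ G h) => i; rewrite ffunE.
Qed.

Lemma DLadj_sym : symmetric (@DLadj d q T).
Proof.
suff imp x y : DLadj x y -> DLadj y x by move=> x y; apply/idP/idP; apply: imp.
case/existsP=> i /existsP[j /and4P[ij ei ej /forallP ek]].
apply/existsP; exists i; apply/existsP; exists j.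
rewrite ij adj_sym ei adj_sym ej; apply/forallP => k.
by apply/implyP => h; rewrite eq_sym; apply: (implyP (ek k)) h.
Qed.

Lemma sum_indicator (i : 'I_d) : \sum_(k < d) (k == i : nat) = 1.
Proof. by rewrite (bigD1 i) //= eqxx big1 // => k /negbTE->. Qed.

Lemma DL_move_exists (u v : 'I_d -> nat) x :
  \sum_i u i = \sum_i v i ->
  exists z, forall i, coords z i = iter (v i) child (iter (u i) par (coords x i)).
Proof.
move=> uv; apply: DL_mk.
rewrite (eq_bigr (fun i => busemann (coords x i) - (u i)%:Z + (v i)%:Z)%R); last first.
  by move=> i _; rewrite busemann_child // busemann_iter.
by rewrite big_split /= DL_height_sub -(big_morph Posz PoszD (erefl _)) uv addNr.
Qed.

(** Each edge uses one upward and one downward step in two coordinates.  No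
    coordinate needs both kinds of steps, so an upward and a downward step that
    remain always belong to different coordinates. *)
Lemma balanced_move n (u v : 'I_d -> nat) x z :
  (forall i, u i = 0 \/ v i = 0) -> \sum_i u i = n -> \sum_i v i = n ->
  (forall i, coords z i = iter (v i) child (iter (u i) par (coords x i))) ->
  walk (@DLadj d q T) n x z.
Proof.
elim: n u v x => [|n IH] u v x dis su sv zE.
  have u0 i : u i = 0.
    by move/eqP: su; rewrite sum_nat_eq0 => /forallP/(_ i)/implyP/(_ isT)/eqP.
  have v0 i : v i = 0.
    by move/eqP: sv; rewrite sum_nat_eq0 => /forallP/(_ i)/implyP/(_ isT)/eqP.
  have -> : z = x by apply: DL_ext => i; rewrite zE u0 v0.
  exact: walk0.
have pick_pos (w : 'I_d -> nat) : \sum_i w i = n.+1 -> exists i, 0 < w i.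
  move=> sw; apply: contrapT => no; suff : \sum_i w i = 0 by rewrite sw.
  apply: big1 => i _; apply/eqP; rewrite -leqn0 leqNgt; apply/negP => wi.
  by apply: no; exists i.
have [i ui] := pick_pos u su; have [j vj] := pick_pos v sv.
have ij : i != j.
  by apply/eqP => eij; case: (dis i) => h; move: ui vj; rewrite ?eij -?eij h.
have dec (w : 'I_d -> nat) l : 0 < w l -> \sum_k w k = n.+1 ->
    \sum_k (w k - (k == l)) = n.
  move=> wl sw; apply/eqP; rewrite -eqSS -sw -(addn1 (\sum_k _)) -(sum_indicator l).
  rewrite -big_split /=; apply/eqP; apply: eq_bigr => k _; rewrite subnK //.
  by have [->|] := eqVneq k l.
have [y yE] := @DL_move_exists (fun k => (k == i : nat)) (fun k => (k == j : nat)) x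
  (etrans (sum_indicator i) (esym (sum_indicator j))).
rewrite -add1n; apply: (@walkD _ _ _ _ _ y).
  apply: walk1; apply/existsP; exists i; apply/existsP; exists j.
  rewrite ij !yE !eqxx (negbTE ij) [j == i]eq_sym (negbTE ij) /= adj_par.
  rewrite adjE; have /= -> := iter_par_child 1 (coords x j) (q_gt0 j).
  rewrite eqxx orbT /=.
  apply/forallP => k; apply/implyP => /andP[/negbTE ki /negbTE kj].
  by rewrite yE ki kj.
apply: (IH (fun k => u k - (k == i)) (fun k => v k - (k == j))).
- by move=> k; case: (dis k) => ->; [left|right]; rewrite sub0n.
- exact: dec.
- exact: dec.
move=> k; rewrite zE yE.
have [->|ki] := eqVneq k i.
  rewrite (negbTE ij) subn0 /= -iterSr subn1 prednK //.
have [->|kj] := eqVneq k j; last by rewrite !subn0.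
have -> : u j = 0 by case: (dis j) => // vj0; rewrite vj0 in vj.
by rewrite /= -iterSr subn1 prednK.
Qed.

Lemma DL_move (u v : 'I_d -> nat) x :
  (forall i, u i = 0 \/ v i = 0) -> \sum_i u i = \sum_i v i ->
  exists2 z, forall i, coords z i = iter (v i) child (iter (u i) par (coords x i))
    & walk (@DLadj d q T) (\sum_i u i) x z.
Proof.
move=> dis uv; have [z zE] := DL_move_exists x uv; exists z => //.
exact: balanced_move dis _ (esym uv) zE.
Qed.

Hypothesis d_ge2 : 2 <= d.

(** From [x], raise all coordinates but [i0] to the common ancestors with the
    coordinates of [y] while [i0] descends along first children; then raise
    [i0] back along its descent and on to its common ancestor while [i1]
    descends.  The same procedure from [y], with as many steps upward in total,
    ends at the same vertex. *)
Lemma DL_walk_le x y : exists2 n, n <= 2 * \sum_i tdist (coords x i) (coords y i)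
  & walk (@DLadj d q T) n x y.
Proof.
have /choice[c cP] i : exists p : nat * nat,
    p.1 + p.2 <= tdist (coords x i) (coords y i) /\
    iter p.1 par (coords x i) = iter p.2 par (coords y i).
  by have [m [n mn]] := tdist_confluent (coords x i) (coords y i); exists (m, n).
pose m i := (c i).1; pose n i := (c i).2.
have mn i : iter (m i) par (coords x i) = iter (n i) par (coords y i).
  by case: (cP i).
have le : \sum_i m i + \sum_i n i <= \sum_i tdist (coords x i) (coords y i).
  by rewrite -big_split /=; apply: leq_sum => i _; case: (cP i).
have eq_mn : \sum_i m i = \sum_i n i.
  suff : ((\sum_i m i)%:Z = (\sum_i n i)%:Z)%R by case.
  have : (\sum_i (busemann (coords x i) - (m i)%:Z) =
          \sum_i (busemann (coords y i) - (n i)%:Z))%R.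
    by apply: eq_bigr => i _; rewrite -!busemann_iter mn.
  by rewrite !DL_height_sub => /oppr_inj.
pose i0 : 'I_d := Ordinal (ltnW d_ge2); pose i1 : 'I_d := Ordinal d_ge2.
have i10 : (i1 == i0) = false by [].
have only (i : 'I_d) a : \sum_k (if k == i then a else 0) = a.
  by rewrite -big_mkcond big_pred1_eq.
pose S (w : 'I_d -> nat) := \sum_(k | k != i0) w k.
have sumS w : \sum_k (if k == i0 then 0 else w k) = S w.
  by rewrite /S [RHS]big_mkcond; apply: eq_bigr => k _; case: eqP.
have climb w (z : DL T) : exists2 z', walk (@DLadj d q T) (S w + \sum_i w i) z z' &
    [/\ coords z' i0 = iter (w i0) par (coords z i0),
        coords z' i1 = iter (\sum_i w i) child (iter (w i1) par (coords z i1))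
      & forall k, k != i0 -> k != i1 -> coords z' k = iter (w k) par (coords z k)].
  have [||z1 z1E w1] := @DL_move (fun k => if k == i0 then 0 else w k)
    (fun k => if k == i0 then S w else 0) z.
  - by move=> i; case: eqP; [left|right].
  - by rewrite sumS only.
  have [||z2 z2E w2] := @DL_move (fun k => if k == i0 then \sum_i w i else 0)
    (fun k => if k == i1 then \sum_i w i else 0) z1.
  - by move=> i; have [->|_] := eqVneq i i0; [right|left].
  - by rewrite !only.
  rewrite sumS in w1; rewrite only in w2.
  exists z2; first exact: walkD w1 w2.
  split.
  - rewrite z2E z1E eqxx /= (bigD1 i0) //= -/(S w) iterD iter_par_child //.
  - by rewrite z2E z1E eqxx i10.
  - by move=> k k0 k1; rewrite z2E z1E (negbTE k0) (negbTE k1).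
have [z wz [z0 z1 zk]] := climb m x; have [z' wz' [z0' z1' zk']] := climb n y.
have zz : z = z'.
  apply: DL_ext => k; have [->|k0] := eqVneq k i0; first by rewrite z0 z0' mn.
  have [->|k1] := eqVneq k i1; first by rewrite z1 z1' mn eq_mn.
  by rewrite zk // zk' // mn.
exists ((S m + \sum_i m i) + (S n + \sum_i n i)); last first.
  by apply: walkD wz _; rewrite zz; apply: walk_sym wz'; apply: DLadj_sym.
have Sle w : S w <= \sum_i w i by rewrite (bigD1 i0) //= leq_addl.
by move: le (Sle m) (Sle n); lia.
Qed.

Local Notation DLd := (gdist (@DLadj d q T)).

Lemma DL_gdist_le x y : DLd x y <= 2 * \sum_i tdist (coords x i) (coords y i).
Proof. by have [n le w] := DL_walk_le x y; apply: leq_trans (gdist_le w) le. Qed.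

Lemma sum_tdist_le x y : \sum_i tdist (coords x i) (coords y i) <= 2 * DLd x y.
Proof.
have w : walk (@DLadj d q T) (DLd x y) x y.
  by have [n _ w] := DL_walk_le x y; apply: gdist_walk w.
move: (DLd x y) w => n w.
elim: n x w => [|n IH] x.
  by move=> [p [_ <- /size0nil ->]] /=; rewrite big1 // => i _; rewrite tdistxx.
case/(@walkS _ (@DLadj d q T)) => z.
move=> /existsP[i /existsP[j /and4P[_ ei ej /forallP ek]]] /IH le.
apply: (@leq_trans (\sum_k ((k == i) + (k == j) + tdist (coords z k) (coords y k)))).
  apply: leq_sum => k _; apply: leq_trans (tdist_triangle (coords z k) _ _) _.
  rewrite leq_add2r; have [->|ki] := eqVneq k i.
    by rewrite (leq_trans (tdist_adj ei)).
  have [->|kj] := eqVneq k j; first by rewrite (leq_trans (tdist_adj ej)).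
  by have := ek k; rewrite ki kj => /eqP ->; rewrite tdistxx.
by rewrite !big_split /= !sum_indicator mulnS leq_add2l.
Qed.

End DLMetric.

(** * The quasi-isometry and the lifted group *)

Section LevelMap.
Variables (d s : nat) (q q' : 'I_d -> nat).
Variables (T : forall i, homTree (q i)) (Ts : forall i, homTree (q' i)).
Variable psi : forall i, Ts i -> T i.
Arguments psi : clear implicits.
Hypotheses (d_ge2 : 2 <= d) (s_gt0 : 0 < s).
Hypotheses (q_gt0 : forall i, 0 < q i) (q'_gt0 : forall i, 0 < q' i).
Hypothesis psi_inj : forall i, injective (psi i).
Hypothesis psi_par : forall i x, psi i (par x) = iter s par (psi i x).
Hypothesis psi_height :
  forall i x, (busemann (psi i x) = busemann x * s%:Z)%R.
Hypothesis psi_onto : forall i y, (s %| busemann y)%Z -> exists x, psi i x = y.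

Lemma level_map_exists (x : DL Ts) :
  exists y : DL T, forall i, coords y i = psi i (coords x i).
Proof.
apply: DL_mk; under eq_bigr do rewrite psi_height.
by rewrite -mulr_suml DL_height mul0r.
Qed.

Definition level_map x : DL T := projT1 (cid (level_map_exists x)).

Lemma level_mapE x i : coords (level_map x) i = psi i (coords x i).
Proof. exact: (projT2 (cid (level_map_exists x))). Qed.

Lemma level_map_onto (y : DL T) : (forall i, (s %| busemann (coords y i))%Z) ->
  exists x, level_map x = y.
Proof.
move=> hy; pose F i := projT1 (cid (psi_onto (hy i))).
have FE i : psi i (F i) = coords y i by exact: (projT2 (cid (psi_onto (hy i)))).
have s0 : s%:Z%R != 0%R by rewrite eqz_nat -lt0n.
have [|x xE] := @DL_mk d q' Ts F.
  apply: (mulIf s0); rewrite mul0r mulr_suml -[RHS](DL_height y).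
  by apply: eq_bigr => i _; rewrite -psi_height FE.
by exists x; apply: DL_ext => i; rewrite level_mapE xE FE.
Qed.

Local Notation distT := (gdist (@DLadj d q T)).
Local Notation distTs := (gdist (@DLadj d q' Ts)).

Lemma level_map_dist_le x y :
  distT (level_map x) (level_map y) <= (4 * s) * distTs x y.
Proof.
apply: leq_trans (DL_gdist_le q_gt0 d_ge2 _ _) _.
rewrite (_ : 4 * s = 2 * (s * 2)); last by rewrite [s * 2]mulnC mulnA.
rewrite -2!mulnA leq_mul2l /=.
apply: (@leq_trans (s * \sum_i tdist (coords x i) (coords y i))); last first.
  by rewrite leq_mul2l sum_tdist_le ?orbT.
rewrite big_distrr /=; apply: leq_sum => i _; rewrite !level_mapE.
exact: (level_tdist_le (@psi_par i)).
Qed.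

Lemma dist_le_level_map x y :
  distTs x y <= 4 * distT (level_map x) (level_map y).
Proof.
apply: leq_trans (DL_gdist_le q'_gt0 d_ge2 _ _) _.
rewrite (_ : 4 = 2 * 2) // -mulnA leq_mul2l /=.
apply: leq_trans (sum_tdist_le q_gt0 d_ge2 _ _).
apply: leq_sum => i _; rewrite !level_mapE.
exact: (tdist_le_level s_gt0 (@psi_inj i) (@psi_par i) (@psi_height i)).
Qed.

(** Every coordinate but [i0] climbs at most [s - 1] steps to the level set while
    [i0] descends to compensate; the height of coordinate [i0] is then divisible
    by [s] because the heights add up to 0. *)
Lemma level_map_dense (z : DL T) : exists x, distT z (level_map x) <= d * s.
Proof.
have /choice[r rP] i : exists n, n < s /\ (s %| (busemann (coords z i) - n%:Z)%R)%Z.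
  by have [n ns dn] := level_below (busemann (coords z i)) s_gt0; exists n.
pose i0 : 'I_d := Ordinal (ltnW d_ge2).
have [||w wE wz] := @DL_move d q T q_gt0 (fun i => if i == i0 then 0 else r i)
  (fun i => if i == i0 then \sum_k (if k == i0 then 0 else r k) else 0) z.
- by move=> i; case: eqP; [left|right].
- by rewrite -[RHS]big_mkcond big_pred1_eq.
have dvd i : i != i0 -> (s %| busemann (coords w i))%Z.
  move=> /negbTE ni; rewrite wE ni busemann_iter.
  by have [_] := rP i.
have [|x xw] := @level_map_onto w.
  move=> i; have [->|/dvd//] := eqVneq i i0.
  have := DL_height w; rewrite (bigD1 i0) //= => /eqP.
  by rewrite addr_eq0 => /eqP->; rewrite rpredN rpred_sum.
exists x; rewrite xw; apply: leq_trans (gdist_le wz) _.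
rewrite -[d in d * s]card_ord -sum_nat_const; apply: leq_sum => i _.
by case: eqP => // _; have [/ltnW] := rP i.
Qed.

Lemma level_map_quasi_isometry (R : realType) :
  quasi_isometry (@DLdist R d _ Ts) (@DLdist R d _ T) level_map.
Proof.
have A0 : (0 < (4 * s)%:R :> R)%R by rewrite ltr0n muln_gt0.
have B0 : (0 <= (d * s)%:R :> R)%R by rewrite ler0n.
exists (4 * s)%:R%R, (d * s)%:R%R; split=> //.
  move=> x y; rewrite /DLdist; split.
    rewrite lerBlDr ler_wpDr // ler_pdivrMl // -natrM ler_nat.
    exact: level_map_dist_le.
  rewrite ler_wpDr // -natrM ler_nat (leq_trans (dist_le_level_map x y)) //.
  by rewrite leq_mul2r leq_pmulr ?orbT.
move=> z; have [x le] := level_map_dense z.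
apply: le_trans (_ : ((DLdist R z (level_map x))%:E <= _)%E).
  by apply: ereal_inf_lbound; exists x.
by rewrite lee_fin ler_nat.
Qed.

Definition lift_maps (g : treeMaps T) : treeMaps Ts := fun i => level_lift (psi i) (g i).

Section Subgroup.
Variable G : set (treeMaps T).
Hypothesis G_subgroup : subgroup_DL G.
Local Notation Gs := (level_subgroup s G).

Let G_Aff g i : Gs g -> Aff (g i).
Proof. by have [sub _ _ _] := G_subgroup; case=> /sub[aff _]. Qed.

Let G_shift g i : Gs g -> (s %| shift (g i))%Z.
Proof. by case. Qed.

Lemma lift_mapsP g i x : Gs g -> psi i (lift_maps g x) = g i (psi i x).
Proof.
move=> Gg; exact: (liftP (@psi_height i) (@psi_onto i) (G_Aff i Gg) (G_shift i Gg)).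
Qed.

Lemma lift_maps_act g x y : Gs g ->
  maps_act (lift_maps g) (coords x) = coords y <->
  maps_act g (coords (level_map x)) = coords (level_map y).
Proof.
move=> Gg; rewrite -!ffunP; split=> gxy i; have := gxy i; rewrite !ffunE.
  by rewrite !level_mapE -lift_mapsP // => ->.
by rewrite !level_mapE -lift_mapsP // => /psi_inj.
Qed.

Lemma lift_maps_embedding : group_embedding Gs (@DLgroup d _ Ts) lift_maps.
Proof.
have s0 : s%:Z%R != 0%R by rewrite eqz_nat -lt0n.
have [sub _ _ _] := G_subgroup; split.
- move=> g Gg; split=> [i|].
    exact: (Aff_lift (@psi_inj i) (@psi_par i) (@psi_height i) (@psi_onto i)
      (G_Aff i Gg) (G_shift i Gg)).
  have [_ sg] := sub _ Gg.1.
  apply: (mulIf s0); rewrite mul0r mulr_suml -[RHS]sg.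
  apply: eq_bigr => i _.
  exact: (shift_lift (@psi_inj i) (@psi_par i) (@psi_height i) (@psi_onto i)
    (G_Aff i Gg) (G_shift i Gg)).
- move=> g h Gg Gh; apply: functional_extensionality_dep => i.
  apply/funext => x; apply: psi_inj.
  have Ggh : Gs (maps_comp g h).
    split=> [|k].
      by have [_ _ comp _] := G_subgroup; apply: comp; [case: Gg|case: Gh].
    rewrite /shift /maps_comp (busemann_Aff _ (G_Aff k Gg)) addrAC.
    by rewrite rpredD //; [apply: G_shift Gh|apply: G_shift Gg].
  by rewrite lift_mapsP // /maps_comp !lift_mapsP.
- move=> g h Gg Gh eq; apply: functional_extensionality_dep => i.
  apply: (level_lift_faithful s_gt0 (@psi_height i) (@psi_onto i) (q_gt0 i)
    (G_Aff i Gg) (G_Aff i Gh) (G_shift i Gg) (G_shift i Gh)).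
  exact: (congr1 (fun f => f i) eq).
Qed.

(** An element of [G] that maps [level_map x] to [level_map y] shifts every
    height by a multiple of [s], so it lies in the level subgroup. *)
Lemma lift_maps_transitive : DLtransitive G -> DLtransitive (lift_maps @` Gs).
Proof.
move=> tr x y; have [g Gg gxy] := tr (level_map x) (level_map y).
have Gsg : Gs g.
  split=> // i; have [/(_ g Gg) [/(_ i) aff _] _ _ _] := G_subgroup.
  have := congr1 (fun f : {dffun forall i : 'I_d, T i} => busemann (f i)) gxy.
  rewrite ffunE !level_mapE busemann_Aff // !psi_height => e.
  suff -> : shift (g i) = ((busemann (coords y i) - busemann (coords x i)) * s%:Z)%R.
    exact: dvdz_mull.
  by rewrite mulrBl -e [(_ + shift _)%R]addrC addrK.
by exists (lift_maps g); [exists g|apply/lift_maps_act].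
Qed.

Lemma lift_maps_free : DLfree G -> DLfree (lift_maps @` Gs).
Proof.
move=> fr x _ [g Gg <-] /(lift_maps_act _ _ Gg) gx.
have [Gg1 _] := Gg; have g1 := fr _ _ Gg1 gx.
apply: functional_extensionality_dep => i; apply/funext => y; apply: psi_inj.
by rewrite lift_mapsP // g1.
Qed.

End Subgroup.
End LevelMap.

Local Close Scope nat_scope.

Theorem mainTheorem7 (R : realType) (d s : nat) (q : 'I_d -> nat)
    (hd : (2 <= d)%N) (hq : forall i, (2 <= q i)%N) (hs : (2 <= s)%N)
    (T : forall i : 'I_d, homTree (q i))
    (Ts : forall i : 'I_d, homTree (q i ^ s)%N) :
  exists phi : DL Ts -> DL T,
    quasi_isometry (@DLdist R d _ Ts) (@DLdist R d _ T) phi /\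
    forall G : set (treeMaps T), subgroup_DL G ->
      exists f : treeMaps T -> treeMaps Ts,
        [/\ group_embedding (level_subgroup s G) (@DLgroup d _ Ts) f,
            (forall g, level_subgroup s G g -> forall x y : DL Ts,
               maps_act (f g) (coords x) = coords y ->
               maps_act g (coords (phi x)) = coords (phi y)),
            (DLtransitive G -> DLtransitive (f @` level_subgroup s G))
          & (DLfree G -> DLfree (f @` level_subgroup s G))].
Proof.
have s0 : (0 < s)%N by apply: ltnW.
have q0 i : (0 < q i)%N by apply: ltnW.
have qs0 i : (0 < q i ^ s)%N by rewrite expn_gt0 q0.
pose ex i := cid (@level_embedding (q i) s (T i) (Ts i) s0).
pose psi i := projT1 (ex i).
have psi_inj i : injective (psi i) by have [] := projT2 (ex i).
have psi_par i x : psi i (par x) = iter s par (psi i x).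
  by have [_ + _ _] := projT2 (ex i); apply.
have psi_height i x : (busemann (psi i x) = busemann x * s%:Z)%R.
  by have [_ _ + _] := projT2 (ex i); apply.
have psi_onto i y : (s %| busemann y)%Z -> exists x, psi i x = y.
  by have [_ _ _] := projT2 (ex i); apply.
exists (level_map psi_height); split.
  exact: (level_map_quasi_isometry hd s0 q0 qs0 psi_inj psi_par).
move=> G sG; exists (lift_maps psi); split.
- exact: lift_maps_embedding.
- by move=> g Gg x y /(lift_maps_act psi_inj psi_height psi_onto sG _ _ Gg).
- exact: lift_maps_transitive.
- exact: lift_maps_free.
Qed.
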